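(* Let $\mathcal{A}=(A,\mathcal{R})$ be a nontrivial amorphic $C$-algebra with unit $e$, put $\mathcal{R}^\#=\mathcal{R}\setminus\{e\}$, $n=\sum_{r\in\mathcal{R}}d_r$ and $d'_r=n-1-d_r$ for $r\in\mathcal{R}^\#$. Then the structure constants of $\mathcal{A}$ are uniquely determined by the multiset $D(\mathcal{A})=\{d_r:\ r\in\mathcal{R}\}$ and a number $\varepsilon\in\{-1,+1\}$. More exactly, there is $\varepsilon\in\{-1,+1\}$ such that for all $r,s,t\in\mathcal{R}^\#$ $$ c_{r,s}^t=\begin{cases} \dfrac{d_rd_s}{(\sqrt{n}+\varepsilon)^2}, & \text{if } r\ne s\ne t\ne r,\\[6pt] \dfrac{d_r}{2}\left(1+\dfrac{d_r-d'_r}{(\sqrt{n}+\varepsilon)^2}\right), & \text{if } r=s\ne t,\\[6pt] -\dfrac{d'_r}{2}\left(1+\dfrac{d_r-d'_r}{(\sqrt{n}+\varepsilon)^2}\right)+d_r-1, & \text{if } r=s=t, \end{cases} $$ and these values determine all structure constants: if $(A_1,\mathcal{R}_1)$ and $(A_2,\mathcal{R}_2)$ are nontrivial amorphic $C$-algebras satisfying these formulas with the same $\varepsilon$, and $f:\mathcal{R}_1\to\mathcal{R}_2$ is a bijection taking unit to unit and preserving the numbers $d_r$, then $c_{f(r),f(s)}^{f(t)}=c_{r,s}^t$ for all $r,s,t\in\mathcal{R}_1$.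
   Context: $C$-algebra: a pair $\mathcal{A}=(A,\mathcal{R})$ where $A$ is a finite-dimensional associative algebra over $\mathbb{C}$ with unit $e$ and a semilinear involutive anti-automorphism $*$, and $\mathcal{R}$ is a linear basis of $A$ with structure constants defined by $r\cdot s=\sum_{t\in\mathcal{R}}c_{r,s}^t t$ ($r,s\in\mathcal{R}$), such that: (C1) $e\in\mathcal{R}$ and $r^*\in\mathcal{R}$ for all $r\in\mathcal{R}$; (C2) $c_{r,s}^t\in\mathbb{R}$ for all $r,s,t\in\mathcal{R}$; (C3) for all $r,s\in\mathcal{R}$, $c_{r,s}^e=d_r\delta_{r^*,s}$ where $d_r>0$ and $\delta$ is the Kronecker symbol; (C4) the linear functional on $A$ defined by $r\mapsto d_r$ ($r\in\mathcal{R}$) is a one-dimensional $*$-representation of $A$. Fusion: for a partition $\pi$ of $\mathcal{R}$ with $\{e\}\in\pi$, the $\pi$-fusion of $\mathcal{A}$ is the pair $\mathcal{A}_\pi=(A_\pi,\mathcal{R}_\pi)$ where $\mathcal{R}_\pi=\{\sum_{r\in R}r:\ R\in\pi\}$ and $A_\pi$ is the linear span of $\mathcal{R}_\pi$; it is a $C$-algebra (with the inherited operations) iff $A_\pi$ is a $*$-subalgebra of $A$. Amorphic: $\mathcal{A}$ is amorphic if for every partition $\pi$ of $\mathcal{R}$ with $\{e\}\in\pi$ the $\pi$-fusion $\mathcal{A}_\pi$ is a $C$-algebra. An amorphic $C$-algebra is trivial if $|\mathcal{R}|\le 3$ (every $C$-algebra of dimension at most $3$ is amorphic), and nontrivial if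 $|\mathcal{R}|\ge 4$. *)

(* Defs.v *)
From mathcomp Require Import all_boot all_order all_algebra all_field.
From mathcomp Require Import reals.
From mathcomp Require Import complex.

Set Implicit Arguments.
Unset Strict Implicit.
Unset Printing Implicit Defensive.

Import Order.TTheory GRing.Theory Num.Theory.
Local Open Scope ring_scope.
Local Open Scope complex_scope.

(* The coefficient of the basis element X_t in X_r * X_s. *)
Definition strc (R : realType) (A : falgType R[i]) (k : nat) (X : k.-tuple A)
    (r s t : 'I_k) : R[i] :=
  coord X t (tnth X r * tnth X s).

(* The linear functional on the span of X with X_r |-> d r. *)
Definition degree_functional (R : realType) (A : falgType R[i]) (k : nat)
    (X : k.-tuple A) (d : 'I_k -> R) (x : A) : R[i] :=
  \sum_(r < k) coord X r x * (d r)%:C.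

(* (U, X) is a C-algebra for the multiplication and the map star inherited    *)
(* from an ambient algebra A, with unit X_e = 1 and degrees d. A C-algebra    *)
(* in its own right is the case U = fullv (see calgebra); the general case    *)
(* is needed for fusions. The set of basis elements is given by its           *)
(* enumeration X, which is duplicate-free because it is a basis. The degrees  *)
(* d are determined by the other data, because of calg_C1_star and calg_C3.   *)
Record is_calgebra (R : realType) (A : falgType R[i]) (star : A -> A)
    (U : {vspace A}) (k : nat) (X : k.-tuple A) (e : 'I_k) (d : 'I_k -> R)
    : Prop := IsCalgebra {
  calg_basis : basis_of U X;
  calg_mul : {in U &, forall x y, x * y \in U};
  calg_star : {in U, forall x, star x \in U};
  calg_star_semilinear :
    forall a : R[i], {in U &, forall x y,
      star (a *: x + y) = a^*%R *: star x + star y};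
  calg_starK : {in U, forall x, star (star x) = x};
  calg_starM : {in U &, forall x y, star (x * y) = star y * star x};
  calg_C1_unit : tnth X e = 1;
  calg_C1_star : forall r, star (tnth X r) \in X;
  calg_C2 : forall r s t, strc X r s t \is Num.real;
  calg_C3_pos : forall r, 0 < d r;
  calg_C3 : forall r s,
    strc X r s e = (d r)%:C * (star (tnth X r) == tnth X s)%:R;
  calg_C4_unit : degree_functional X d 1 = 1;
  calg_C4_mul : {in U &, forall x y,
    degree_functional X d (x * y)
      = degree_functional X d x * degree_functional X d y};
  calg_C4_star : {in U, forall x,
    degree_functional X d (star x) = (degree_functional X d x)^*%R}
}.

Record calgebra (R : realType) : Type := Calgebra {
  calg_alg : falgType R[i];
  calg_starmap : calg_alg -> calg_alg;
  calg_size : nat;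
  calg_elts : calg_size.-tuple calg_alg;
  unit_idx : 'I_calg_size;
  deg : 'I_calg_size -> R;
  calgebraP : is_calgebra calg_starmap fullv calg_elts unit_idx deg
}.

Definition structure_constant (R : realType) (C : calgebra R)
    (r s t : 'I_(calg_size C)) : R[i] :=
  strc (calg_elts C) r s t.

Definition fusion_elts (R : realType) (C : calgebra R)
    (pi : {set {set 'I_(calg_size C)}}) : #|pi|.-tuple (calg_alg C) :=
  image_tuple
    (fun P : {set 'I_(calg_size C)} => \sum_(r in P) tnth (calg_elts C) r) (mem pi).

Definition fusion_space (R : realType) (C : calgebra R)
    (pi : {set {set 'I_(calg_size C)}}) : {vspace calg_alg C} :=
  <<fusion_elts pi>>%VS.

Definition fusion_is_calgebra (R : realType) (C : calgebra R)
    (pi : {set {set 'I_(calg_size C)}}) : Prop :=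
  exists (e : 'I_#|pi|) (d : 'I_#|pi| -> R),
    is_calgebra (@calg_starmap R C) (fusion_space pi) (fusion_elts pi) e d.

Definition amorphic (R : realType) (C : calgebra R) : Prop :=
  forall pi : {set {set 'I_(calg_size C)}},
    partition pi [set: 'I_(calg_size C)] -> [set unit_idx C] \in pi ->
    fusion_is_calgebra pi.

Definition nontrivial (R : realType) (C : calgebra R) : Prop :=
  (4 <= calg_size C)%N.

Definition calg_order (R : realType) (C : calgebra R) : R :=
  \sum_(r < calg_size C) deg r.

(* The multiset D(C), to be compared up to perm_eq. *)
Definition degree_multiset (R : realType) (C : calgebra R) : seq R :=
  [seq deg r | r : 'I_(calg_size C)].

Definition codeg (R : realType) (C : calgebra R) (r : 'I_(calg_size C)) : R :=
  calg_order C - 1 - deg r.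

Definition amorphic_formulas (R : realType) (C : calgebra R) (eps : R) : Prop :=
  let q := (Num.sqrt (calg_order C) + eps) ^+ 2 in
  forall r s t : 'I_(calg_size C),
    r != unit_idx C -> s != unit_idx C -> t != unit_idx C ->
    [/\ r != s -> s != t -> t != r ->
          structure_constant r s t = (deg r * deg s / q)%:C,
        r = s -> s != t ->
          structure_constant r s t
            = (deg r / 2 * (1 + (deg r - codeg r) / q))%:C
      & r = s -> s = t ->
          structure_constant r s t
            = (- (codeg r / 2) * (1 + (deg r - codeg r) / q) + deg r - 1)%:C].

(* Main.v *)
Require Import Defs.
From mathcomp Require Import all_boot all_order all_algebra all_field perm.
From mathcomp Require Import reals.
From mathcomp Require Import complex.
From mathcomp Require Import ring lra.

(** The existence of the sign rests on fusions that isolate a few basis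
    elements and merge all others into one block. The product of two isolated
    elements [r] and [s] lies in such a fusion, so [c_rs^t] takes a single value
    for all [t] outside [e], [r], [s] ([intersection_number_const]). The star of
    an isolated element lies there too; as there are at least four basis
    elements, the star fixes every one of them ([star_elt]). Hence the algebra
    is commutative, and associativity makes [c_rs^t * d_t] symmetric in its
    three indices ([intersection_number_cycle]).

    The rest concerns real numbers indexed by a finite set. The symmetry
    together with the independence of [t] gives [c_rs^t = lam * d_r * d_s] for
    distinct [r], [s], [t], with one constant [lam]
    ([distinct_structure_constants]). Put [c_rr^t = m_r * d_r] for [t] different
    from [e] and [r]. Comparing degrees in the product of [r] and [s] shows that
    [m_r - lam * d_r] is the same number for all [r], which expresses [m_r] by
    [lam]; degrees in the square of [r] then give [c_rr^r]. Finally the unit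
    coefficients of the equal elements [(r r) (s s)] and [(r s) (r s)] yield
    [lam ^+ 2 * (n - 1) ^+ 2 - 2 * lam * (n + 1) + 1 = 0], after division by the
    sum of the degrees of the elements other than [e], [r], [s], which is
    positive because a fourth element exists. The roots of this quadratic are
    the inverses of [(sqrt n + 1) ^+ 2] and [(sqrt n - 1) ^+ 2]
    ([root_of_order_quadratic]).

    For uniqueness, the constants that the formulas do not give are those with
    an index equal to the unit, which are immediate, and [c_rs^r] for distinct
    [r] and [s], which by symmetry is [c_rr^s * d_s / d_r]. A bijection between
    the bases that respects degrees can be corrected to respect units, since
    both units have degree 1. *)

Set Implicit Arguments.
Unset Strict Implicit.
Unset Printing Implicit Defensive.

Import Order.TTheory GRing.Theory Num.Theory.
Local Open Scope ring_scope.

(** * Functions on a finite set that are constant up to few exceptions *)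

Lemma exists_notin (I : finType) (xs : seq I) :
  (size xs < #|I|)%N -> exists x, x \notin xs.
Proof.
move=> lt_xs; apply/existsP; apply: contraLR lt_xs.
rewrite negb_exists -leqNgt => /forallP all_xs.
apply: leq_trans (card_size xs); apply/subset_leq_card/subsetP => x _.
by have := all_xs x; rewrite negbK.
Qed.

(** Degree sums in an amorphic algebra have summands that are constant off a
    short list, so they reduce to the exceptional terms and the total degree. *)
Lemma sum_constant_outside (R : comPzRingType) (I : finType) (xs : seq I)
    (K : R) (F d : I -> R) :
  uniq xs -> (forall u, u \notin xs -> F u = K) ->
  \sum_u F u * d u = \sum_(u <- xs) (F u - K) * d u + K * \sum_u d u.
Proof.
move=> uniq_xs FK; rewrite (big_uniq _ uniq_xs) [in RHS]big_mkcond mulr_sumr.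
rewrite -big_split /=; apply: eq_bigr => u _.
by case: ifPn => [_|/FK ->]; ring.
Qed.

(** Three indices already suffice: the three pairwise sums determine the three
    values. *)
Lemma constant_of_sums (R : realFieldType) (I : finType) (e : I) (K : R)
    (g : I -> R) :
  (4 <= #|I|)%N ->
  (forall r s, r != e -> s != e -> r != s -> g r + g s = K) ->
  forall r, r != e -> g r = K / 2.
Proof.
move=> card_I gK r re.
have [|s] := @exists_notin I [:: e; r]; first exact: leq_trans card_I.
rewrite !inE !negb_or => /andP[se sr].
have [|t] := @exists_notin I [:: e; r; s]; first exact: leq_trans card_I.
rewrite !inE !negb_or => /and3P[te tr ts].
have := gK r s re se; have := gK r t re te; have := gK s t se te.
rewrite ![r == _]eq_sym [s == t]eq_sym => /(_ ts) h1 /(_ tr) h2 /(_ sr) h3.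
lra.
Qed.

(** The hypothesis lets an edge turn around one endpoint without changing its
    value; any two edges of a complete graph are linked by such turns. *)
Lemma constant_on_pairs (T I : eqType) (e : I) (h : I -> I -> T) :
  (forall r s, h r s = h s r) ->
  (forall r s t, r != e -> s != e -> t != e -> r != s -> r != t ->
    h r s = h r t) ->
  forall r s x y, r != e -> s != e -> x != e -> y != e ->
    r != s -> x != y -> h r s = h x y.
Proof.
move=> hC h_const.
(* If the turn at r would end in a loop, reversing the edge avoids it. *)
suff from_ne r s x y : r != e -> s != e -> x != e -> y != e ->
    r != s -> x != y -> r != y -> h r s = h x y.
  move=> r s x y re se xe ye rs xy; have [ry|] := eqVneq r y; last exact: from_ne.
  by rewrite hC; apply: from_ne => //; rewrite -?ry eq_sym.
move=> re se xe ye rs xy ry.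
rewrite (h_const r s y) // hC (hC x y); apply: h_const => //.
  by rewrite eq_sym.
by rewrite eq_sym.
Qed.

(** With [w] a square root of [n], the quadratic splits as
    [(lam * (w - 1) ^+ 2 - 1) * (lam * (w + 1) ^+ 2 - 1)]; the choice of the
    vanishing factor is the sign. *)
Lemma root_of_order_quadratic (R : rcfType) (n lam : R) : 1 < n ->
  lam ^+ 2 * (n - 1) ^+ 2 - 2 * lam * (n + 1) + 1 = 0 ->
  exists2 eps : R, eps = -1 \/ eps = 1 & lam = ((Num.sqrt n + eps) ^+ 2)^-1.
Proof.
move=> n_gt1 quad; have n_ge0 : 0 <= n by lra.
have w2 := sqr_sqrtr n_ge0; set w := Num.sqrt n in w2 *.
have : (lam * (w - 1) ^+ 2 - 1) * (lam * (w + 1) ^+ 2 - 1) = 0.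
  by rewrite -quad -w2; ring.
move/eqP; rewrite mulf_eq0 !subr_eq0 => /orP[] /eqP lamq;
  [exists (-1); first by left | exists 1; first by right].
all: by symmetry; apply: mulr1_eq; rewrite mulrC.
Qed.

(** * Real structure constants constrained by degrees and symmetry *)

Section AmorphicParameters.

Variables (R : rcfType) (I : finType) (e : I) (d : I -> R).
Variable c : I -> I -> I -> R.
Hypothesis card_I : (4 <= #|I|)%N.
Hypothesis d_gt0 : forall r, 0 < d r.
Hypothesis d_e : d e = 1.
Hypothesis cC : forall r s t, c r s t = c s r t.
Hypothesis c_cycle : forall r s t, c r s t * d t = c s t r * d r.
Hypothesis c_e : forall r s, c r s e = d r * (r == s)%:R.
Hypothesis c_deg : forall r s, \sum_t c r s t * d t = d r * d s.
Hypothesis c_quad : forall r s,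
  \sum_t c r r t * c s s t * d t = \sum_t c r s t * c r s t * d t.
Hypothesis c_const : forall r s t t',
  t \notin [:: e; r; s] -> t' \notin [:: e; r; s] -> c r s t = c r s t'.

Let n := \sum_r d r.

Let d_neq0 r : d r != 0. Proof. by rewrite gt_eqF. Qed.

Let outside r s := odflt e [pick t | t \notin [:: e; r; s]].

Let outsideP r s : outside r s \notin [:: e; r; s].
Proof.
rewrite /outside; case: pickP => [t //|none] /=.
have [|t] := @exists_notin I [:: e; r; s]; first exact: leq_trans card_I.
by rewrite none.
Qed.

(** For distinct [r], [s], [t], the quotient of [c r s t] by [d r * d s] is
    invariant under permuting [r], [s], [t], because [c r s t * d t] is. *)
Let ratio r s := c r s (outside r s) / (d r * d s).

Let ratioE r s t : t \notin [:: e; r; s] ->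
  c r s t = ratio r s * (d r * d s).
Proof.
move=> t_out; rewrite divfK ?mulf_neq0 //.
exact: c_const t_out (outsideP r s).
Qed.

Let ratioC r s : ratio r s = ratio s r.
Proof.
rewrite /ratio cC [d r * _]mulrC.
congr (c _ _ (odflt e _) / _); apply: eq_pick => t.
by rewrite !inE [(t == r) || _]orbC.
Qed.

(** The value [c r s t] does not change with [t], and by symmetry its quotient
    by [d r * d s] does not change with [s] either. *)
Let ratio_const r s t : r != e -> s != e -> t != e -> r != s -> r != t ->
  ratio r s = ratio r t.
Proof.
move=> re se te rs rt; have [->//|st] := eqVneq s t.
have := c_cycle s r t; rewrite cC !ratioE // ?inE ?negb_or.
- move=> E; apply: (mulIf (mulf_neq0 (mulf_neq0 (d_neq0 r) (d_neq0 s)) (d_neq0 t))).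
  by rewrite mulrA E; ring.
- by rewrite se eq_sym rs.
- by rewrite te ![t == _]eq_sym rt st.
Qed.

Lemma distinct_structure_constants : exists lam : R, forall r s t,
  r != e -> s != e -> r != s -> t \notin [:: e; r; s] -> c r s t = lam * (d r * d s).
Proof.
have [|x] := @exists_notin I [:: e]; first exact: leq_trans card_I.
have [|y] := @exists_notin I [:: e; x]; first exact: leq_trans card_I.
rewrite !inE negb_or => /andP[ye yx] xe.
exists (ratio x y) => r s t re se rs t_out; rewrite ratioE //.
by congr (_ * _); apply: constant_on_pairs re se xe ye rs _; rewrite // eq_sym.
Qed.

Let sum_outside2 r (F : I -> R) K : r != e ->
  (forall u, u \notin [:: e; r] -> F u = K) ->
  \sum_u F u * d u = F e + F r * d r + K * (n - 1 - d r).
Proof.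
move=> re FK; rewrite (sum_constant_outside (xs := [:: e; r]) d _ FK).
  by rewrite !big_cons big_nil d_e -/n; ring.
by rewrite /= inE eq_sym re.
Qed.

Let sum_outside3 r s (F : I -> R) K : r != e -> s != e -> r != s ->
  (forall u, u \notin [:: e; r; s] -> F u = K) ->
  \sum_u F u * d u
    = F e + F r * d r + F s * d s + K * (n - 1 - d r - d s).
Proof.
move=> re se rs FK; rewrite (sum_constant_outside (xs := [:: e; r; s]) d _ FK).
  by rewrite !big_cons big_nil d_e -/n; ring.
by rewrite /= !inE negb_or eq_sym re eq_sym se rs.
Qed.

(** All constants become functions of the degrees and of one number [lam];
    associativity restricts [lam] to two values. *)
Lemma amorphic_structure_constants : exists2 eps : R, eps = -1 \/ eps = 1 &
  let q := (Num.sqrt n + eps) ^+ 2 in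
  forall r s t, r != e -> s != e -> t != e ->
    [/\ r != s -> s != t -> t != r -> c r s t = d r * d s / q,
        r = s -> s != t ->
          c r s t = d r / 2 * (1 + (d r - (n - 1 - d r)) / q)
      & r = s -> s = t ->
          c r s t = - ((n - 1 - d r) / 2)
                      * (1 + (d r - (n - 1 - d r)) / q) + d r - 1].
Proof.
have [lam c_distinct] := distinct_structure_constants.
pose m r := ratio r r * d r.
have c_rrt r t : r != e -> t \notin [:: e; r] -> c r r t = m r * d r.
  move=> re; rewrite !inE negb_or => /andP[te tr].
  by rewrite ratioE // ?inE ?negb_or ?te ?tr // /m mulrA.
(* The remaining coefficient of the square of r is forced by degrees. *)
have c_rrr r : r != e -> c r r r = d r - 1 - m r * (n - 1 - d r).
  move=> re; have := c_deg r r; rewrite (sum_outside2 re (c_rrt r ^~ re)).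
  rewrite c_e eqxx mulr1 => E; apply: (mulIf (d_neq0 r)).
  by lra.
have c_rsr r s : r != e -> s != e -> r != s -> c r s r = m r * d s.
  move=> re se rs; have := c_cycle s r r.
  rewrite cC (c_rrt r s) // ?inE ?negb_or ?se 1?eq_sym //.
  by move=> E; apply: (mulIf (d_neq0 r)); rewrite E; ring.
(* Comparing degrees in r * s gives an equation in which r and s separate, so
   that m r - lam * d r does not depend on r. *)
have m_sum r s : r != e -> s != e -> r != s ->
    m r - lam * d r + (m s - lam * d s) = 1 - lam * (n - 1).
  move=> re se rs; have := c_deg r s.
  rewrite (sum_outside3 re se rs (fun u => c_distinct r s u re se rs)).
  rewrite c_e (negbTE rs) mulr0 c_rsr // cC c_rsr // 1?eq_sym // => E.
  apply: (mulIf (mulf_neq0 (d_neq0 r) (d_neq0 s))).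
  by lra.
have mE r : r != e -> m r = (1 + lam * (d r - (n - 1 - d r))) / 2.
  by move/(constant_of_sums card_I m_sum); lra.
have [|r] := @exists_notin I [:: e]; first exact: leq_trans card_I.
have [|s] := @exists_notin I [:: e; r]; first exact: leq_trans card_I.
have [|t] := @exists_notin I [:: e; r; s]; first exact: leq_trans card_I.
rewrite !inE !negb_or => /and3P[te tr ts] /andP[se sr] re.
(* A fourth basis element makes this degree of the complement positive: it is
   the factor to cancel from the quartic identity below. *)
have rest_gt0 : 0 < n - 1 - d r - d s.
  have uniq4 : uniq [:: e; r; s; t].
    by rewrite -rev_uniq /= !inE !negb_or te tr ts se sr re.
  have : \sum_(u <- [:: e; r; s; t]) d u <= n.
    rewrite big_uniq //= /n [leRHS](bigID (fun u => u \in [:: e; r; s; t])) /=.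
    by rewrite lerDl; apply: sumr_ge0 => u _; apply: ltW.
  by rewrite !big_cons big_nil d_e; have := d_gt0 t; lra.
have n_gt1 : 1 < n by have := d_gt0 r; have := d_gt0 s; lra.
have quad : lam ^+ 2 * (n - 1) ^+ 2 - 2 * lam * (n + 1) + 1 = 0.
  have rs : r != s by rewrite eq_sym.
  (* In terms of lam, both sides of the identity differ by a quarter of the
     quadratic times d r * d s * (n - 1 - d r - d s). *)
  have := c_quad r s.
  rewrite (sum_outside3 (K := m r * d r * (m s * d s)) re se rs); last first.
    move=> u; rewrite !inE !negb_or => /and3P[ue ur us].
    by rewrite !c_rrt ?inE ?negb_or ?ue.
  rewrite (sum_outside3 (K := (lam * (d r * d s)) ^+ 2) re se rs); last first.
    by move=> u u_out; rewrite !c_distinct.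
  rewrite !c_e (negbTE rs) !eqxx !mulr1 !mulr0 !c_rrr //.
  rewrite !(c_rrt _ _ re) ?(c_rrt _ _ se) ?inE ?negb_or ?re ?se //.
  rewrite c_rsr // [c r s s]cC c_rsr // !mE // => E.
  apply: (mulfI (mulf_neq0 (mulf_neq0 (d_neq0 r) (d_neq0 s))
                           (lt0r_neq0 rest_gt0))).
  lra.
have [eps eps1 lamE] := root_of_order_quadratic n_gt1 quad.
exists eps => //= {r s t te tr ts se sr re rest_gt0} r s t re se te.
rewrite -lamE; split.
- move=> rs st tr; rewrite (c_distinct r s t) ?inE ?negb_or ?te ?tr //=.
    by rewrite mulrC.
  by rewrite eq_sym.
- move=> <- rt; rewrite c_rrt ?inE ?negb_or ?te ?mE // 1?eq_sym //.
  by ring.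
- by move=> <- <-; rewrite c_rrr // mE //; field.
Qed.

End AmorphicParameters.

(** * Fusions isolating a list of basis elements *)

(** Since [index] returns [size xs] off [xs], the classes are the singletons of
    the entries of [xs] and the complement of [xs]. *)
Definition isolating_partition (I : finType) (xs : seq I) : {set {set I}} :=
  preim_partition (index^~ xs) [set: I].

Lemma mem_isolating_block (I : finType) (xs : seq I) (x y : I) :
  (y \in pblock (isolating_partition xs) x) = (index x xs == index y xs).
Proof.
rewrite pblock_equivalence_partition ?inE // => u v w _ _ _.
by split=> // /eqP ->.
Qed.

Lemma isolating_blockP (I : finType) (xs : seq I) (x : I) :
  pblock (isolating_partition xs) x \in isolating_partition xs.
Proof. by rewrite pblock_mem // (cover_partition (preim_partitionP _ _)) inE. Qed.

Lemma isolating_block1 (I : finType) (xs : seq I) (x : I) :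
  x \in xs -> pblock (isolating_partition xs) x = [set x].
Proof.
move=> x_in; apply/setP=> y; rewrite mem_isolating_block inE eq_sym.
apply/eqP/eqP => [|-> //] E; apply: (index_inj x _ x_in E).
by rewrite -index_mem E index_mem.
Qed.

Section Calgebra.

Variables (R : realType) (C : calgebra R).
Local Notation X := (calg_elts C).
Local Notation e := (unit_idx C).
Local Notation star := (@calg_starmap R C).
Implicit Types r s t : 'I_(calg_size C).

Let CP := calgebraP C.

Let X_free : free X. Proof. exact: basis_free (calg_basis CP). Qed.

Lemma coord_elt r t : coord X t (tnth X r) = (r == t)%:R.
Proof. by rewrite (tnth_nth 0) coord_free. Qed.

Lemma elt_expansion x : x = \sum_t coord X t x *: tnth X t.
Proof.
rewrite [LHS](coord_basis (calg_basis CP)) ?memvf //.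
by apply: eq_bigr => t _; rewrite -tnth_nth.
Qed.

(** A fused basis element has all coordinates 0 or 1, and two indices of one
    block occur in the same fused elements. *)
Lemma fusion_coord_constant pi (P : {set 'I_(calg_size C)}) t t' x :
  trivIset pi -> P \in pi -> t \in P -> t' \in P -> x \in fusion_space pi ->
  coord X t x = coord X t' x.
Proof.
move=> pi_triv Ppi tP t'P /coord_span ->; rewrite !linear_sum /=.
apply: eq_bigr => i _; rewrite !linearZ /=; congr (_ * _).
rewrite -tnth_nth; have /imageP[Q Qpi ->] := mem_tnth i (fusion_elts pi).
have coord_block u : coord X u (\sum_(r in Q) tnth X r) = (u \in Q)%:R.
  rewrite linear_sum /=; under eq_bigr => r _ do rewrite coord_elt.
  have [uQ|uQ] := boolP (u \in Q).
    rewrite (bigD1 u) //= eqxx big1 ?addr0 // => r /andP[_ /negbTE ru].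
    by rewrite ru.
  by rewrite big1 // => r rQ; case: eqP rQ uQ => // -> ->.
have block_sub u v : u \in P -> v \in P -> u \in Q -> v \in Q.
  move=> uP vP uQ.
  by rewrite -(def_pblock pi_triv Qpi uQ) (def_pblock pi_triv Ppi uP).
rewrite !coord_block; congr (nat_of_bool _)%:R.
by apply/idP/idP; apply: block_sub.
Qed.

Lemma mem_fusion_space (pi : {set {set 'I_(calg_size C)}}) P :
  P \in pi -> \sum_(r in P) tnth X r \in fusion_space pi.
Proof. by move=> Ppi; apply/memv_span/image_f. Qed.

Lemma star1 : star 1 = 1.
Proof.
have := calg_starM CP (memvf (star 1)) (memvf 1).
by rewrite mulr1 (calg_starK CP) ?memvf // mulr1.
Qed.

Lemma star_expansion x : star x = \sum_t (coord X t x)^*%R *: star (tnth X t).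
Proof.
have starD := calg_star_semilinear CP.
have star0 : star 0 = 0.
  have := starD 1 0 0 (memvf _) (memvf _).
  rewrite scaler0 add0r rmorph1 scale1r => /eqP.
  by rewrite -subr_eq0 opprD addNKr oppr_eq0 => /eqP.
rewrite {1}(elt_expansion x).
elim/big_rec2: _ => [//|t y z _ IHt].
by rewrite starD ?memvf // IHt.
Qed.

Lemma elt_mul r s :
  tnth X r * tnth X s = \sum_t structure_constant r s t *: tnth X t.
Proof. exact: elt_expansion. Qed.

Definition intersection_number r s t : R :=
  complex.Re (structure_constant r s t).
Local Notation p := intersection_number.

Lemma structure_constantE r s t : structure_constant r s t = (p r s t)%:C%C.
Proof. by rewrite RRe_real // (calg_C2 CP). Qed.

Lemma coord_elt_mul r s t : coord X t (tnth X r * tnth X s) = (p r s t)%:C%C.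
Proof. exact: structure_constantE. Qed.

Lemma intersection_number_1l s t : p (unit_idx C) s t = (s == t)%:R.
Proof.
apply: complexI; rewrite -structure_constantE /structure_constant /strc.
by rewrite (calg_C1_unit CP) mul1r coord_elt rmorph_nat.
Qed.

Lemma degree_functional_elt r :
  degree_functional X (@deg R C) (tnth X r) = (deg r)%:C%C.
Proof.
rewrite /degree_functional (bigD1 r) //= coord_elt eqxx mul1r big1 ?addr0 //.
by move=> s sr; rewrite coord_elt eq_sym (negbTE sr) mul0r.
Qed.

Lemma deg_unit : deg (unit_idx C) = 1.
Proof.
apply: complexI; rewrite -degree_functional_elt (calg_C1_unit CP).
exact: calg_C4_unit CP.
Qed.

Lemma sum_intersection_number_deg r s : \sum_t p r s t * deg t = deg r * deg s.
Proof.
apply: complexI; rewrite rmorphM rmorph_sum /= -!degree_functional_elt.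
rewrite -(calg_C4_mul CP) ?memvf //; apply: eq_bigr => t _.
by rewrite rmorphM /= -structure_constantE.
Qed.

Lemma star_elt_eq1 r : star (tnth X r) = 1 -> r = e.
Proof.
move=> starr; have := calg_starK CP (memvf (tnth X r)).
rewrite starr star1 -(calg_C1_unit CP) => /(congr1 (coord X e)).
by rewrite !coord_elt eqxx; case: eqP => // _ /eqP; rewrite oner_eq0.
Qed.

Section Amorphic.

Hypothesis C_amorphic : amorphic C.
Hypothesis C_nontrivial : nontrivial C.

Let card_idx : (4 <= #|'I_(calg_size C)|)%N.
Proof. by rewrite card_ord. Qed.

Section IsolatingFusion.

Variable xs : seq 'I_(calg_size C).
Hypothesis e_xs : e \in xs.
Local Notation U := (fusion_space (isolating_partition xs)).

Lemma isolating_fusion : fusion_is_calgebra (isolating_partition xs).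
Proof.
apply: C_amorphic; first exact: preim_partitionP.
by rewrite -(isolating_block1 e_xs) isolating_blockP.
Qed.

Lemma mem_isolating_fusion r : r \in xs -> tnth X r \in U.
Proof.
move=> r_xs; have := mem_fusion_space (isolating_blockP xs r).
by rewrite isolating_block1 // big_set1.
Qed.

Lemma isolating_fusion_coord t t' x : t \notin xs -> t' \notin xs ->
  x \in U -> coord X t x = coord X t' x.
Proof.
move=> t_xs t'_xs.
apply: (@fusion_coord_constant _ (pblock (isolating_partition xs) t)).
- by have /and3P[] := preim_partitionP (index^~ xs) [set: 'I_(calg_size C)].
- exact: isolating_blockP.
- by rewrite mem_isolating_block.
- by rewrite mem_isolating_block !memNindex.
Qed.

End IsolatingFusion.

(** The fusion isolating the unit, [r] and [s] contains the product of [r] and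
    [s], whose coefficients are therefore constant on the remaining block. *)
Lemma intersection_number_const r s t t' :
  t \notin [:: e; r; s] -> t' \notin [:: e; r; s] -> p r s t = p r s t'.
Proof.
move=> t_out t'_out; congr complex.Re.
have e_in : e \in [:: e; r; s] by rewrite mem_head.
have [e' [d' U_calg]] := isolating_fusion e_in.
apply: isolating_fusion_coord t_out t'_out _.
by apply: (calg_mul U_calg); apply: mem_isolating_fusion; rewrite // !inE eqxx ?orbT.
Qed.

(** If the star moved a basis element [r] to [u], then [u] would lie in the
    fusion isolating the unit and [r], although a fourth basis element shares
    its block. *)
Lemma star_elt r : star (tnth X r) = tnth X r.
Proof.
have [->|re] := eqVneq r e; first by rewrite (calg_C1_unit CP) star1.
have /tnthP[u rstar] := calg_C1_star CP r; rewrite rstar.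
have [->//|ur] := eqVneq u r; exfalso.
have ue : u != e.
  apply: contraNneq re => ue; apply/eqP/star_elt_eq1.
  by rewrite rstar ue (calg_C1_unit CP).
have e_in : e \in [:: e; r] by rewrite mem_head.
have [e' [d' U_calg]] := isolating_fusion e_in.
have rU : tnth X r \in fusion_space (isolating_partition [:: e; r]).
  by apply: mem_isolating_fusion; rewrite !inE eqxx orbT.
have [|t] := @exists_notin _ [:: e; r; u]; first exact: leq_trans card_idx.
rewrite !inE !negb_or => /and3P[te tr tu].
have uU := calg_star U_calg rU; rewrite rstar in uU.
have := @isolating_fusion_coord [:: e; r] u t _ _ _ uU.
rewrite !inE !negb_or ue ur te tr !coord_elt eqxx eq_sym (negbTE tu).
by move=> /(_ isT isT) /eqP; rewrite oner_eq0.
Qed.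

(** The star reverses products, and it fixes the basis and real combinations of
    basis elements. *)
Lemma elt_mulC r s : tnth X r * tnth X s = tnth X s * tnth X r.
Proof.
rewrite -[in RHS](star_elt r) -[in RHS](star_elt s) -(calg_starM CP) ?memvf //.
rewrite star_expansion [LHS]elt_mul; apply: eq_bigr => t _; rewrite star_elt.
by rewrite (conj_Creal (calg_C2 CP r s t)).
Qed.

Lemma intersection_numberC r s t : p r s t = p s r t.
Proof. by congr complex.Re; rewrite /structure_constant /strc elt_mulC. Qed.

Lemma intersection_number_unit r s : p r s (unit_idx C) = deg r * (r == s)%:R.
Proof.
apply: complexI; rewrite -structure_constantE [LHS](calg_C3 CP) star_elt.
rewrite rmorphM rmorph_nat (inj_eq _) //.
by apply/tuple_uniqP/free_uniq/X_free.
Qed.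

(** The coefficient at the unit is a trace form for which the basis is
    orthogonal with squared norms the degrees; associativity of the product
    turns into the two identities that follow. *)
Lemma coord_unit_mul x y :
  coord X (unit_idx C) (x * y)
    = \sum_t coord X t x * coord X t y * (deg t)%:C%C.
Proof.
rewrite {1}(elt_expansion x) mulr_suml linear_sum; apply: eq_bigr => t _ /=.
rewrite -scalerAl linearZ -mulrA; congr (_ * _).
rewrite {1}(elt_expansion y) mulr_sumr linear_sum (bigD1 t) //= -scalerAr linearZ /=.
rewrite coord_elt_mul intersection_number_unit.
rewrite eqxx mulr1 big1 ?addr0 // => s st.
rewrite -scalerAr linearZ /= coord_elt_mul.
by rewrite intersection_number_unit eq_sym (negbTE st) !mulr0.
Qed.

Lemma intersection_number_cycle r s t : p r s t * deg t = p s t r * deg r.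
Proof.
apply: complexI; rewrite !rmorphM /= -!structure_constantE.
have := congr1 (coord X e) (mulrA (tnth X r) (tnth X s) (tnth X t)).
rewrite !coord_unit_mul (bigD1 r) //= [in RHS](bigD1 t) //= !coord_elt !eqxx.
rewrite mul1r mulr1 !big1 ?addr0 => [-> //|u ut|u ur].
  by rewrite coord_elt eq_sym (negbTE ut) mulr0 mul0r.
by rewrite coord_elt eq_sym (negbTE ur) !mul0r.
Qed.

(** By commutativity the product of the squares of [r] and [s] is the square of
    their product. *)
Lemma intersection_number_quad r s :
  \sum_t p r r t * p s s t * deg t = \sum_t p r s t * p r s t * deg t.
Proof.
apply: complexI; rewrite !rmorph_sum /=.
under eq_bigr do rewrite !rmorphM /= -!coord_elt_mul.
under [RHS]eq_bigr do rewrite !rmorphM /= -!coord_elt_mul.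
rewrite -!coord_unit_mul; congr (coord X _ _).
by rewrite -!mulrA; congr (_ * _); rewrite !mulrA (elt_mulC r).
Qed.

Lemma amorphic_formulas_hold :
  exists2 eps : R, eps = -1 \/ eps = 1 & amorphic_formulas C eps.
Proof.
have [eps eps1 E] := amorphic_structure_constants card_idx (calg_C3_pos CP) deg_unit
  intersection_numberC intersection_number_cycle intersection_number_unit
  sum_intersection_number_deg intersection_number_quad
  intersection_number_const.
exists eps => // q r s t re se te; rewrite structure_constantE.
have [E1 E2 E3] := E r s t re se te.
by split=> *; [rewrite E1 | rewrite E2 | rewrite E3].
Qed.

End Amorphic.

End Calgebra.

(** * Uniqueness of the structure constants *)

(** Away from the unit, the formulas leave out one kind of constant: the
    coefficient, in a product of distinct elements, of one of the factors. *)
Lemma intersection_number_rsr (R : realType) (C : calgebra R)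
    (r s : 'I_(calg_size C)) : amorphic C -> nontrivial C ->
  intersection_number r s r = intersection_number r r s * deg s / deg r.
Proof.
move=> C_am C_nt; have d_neq0 : deg r != 0.
  by rewrite gt_eqF // (calg_C3_pos (calgebraP C)).
apply: (mulIf d_neq0); rewrite divfK // intersection_numberC //.
exact: intersection_number_cycle.
Qed.

Section Uniqueness.

Variables (R : realType) (C1 C2 : calgebra R) (eps : R).
Hypothesis amorphic1 : amorphic C1.
Hypothesis nontrivial1 : nontrivial C1.
Hypothesis amorphic2 : amorphic C2.
Hypothesis nontrivial2 : nontrivial C2.
Hypothesis formulas1 : amorphic_formulas C1 eps.
Hypothesis formulas2 : amorphic_formulas C2 eps.

Lemma structure_constants_determined
    (f : 'I_(calg_size C1) -> 'I_(calg_size C2)) :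
  bijective f -> f (unit_idx C1) = unit_idx C2 ->
  (forall r, deg (f r) = deg r) ->
  forall r s t,
    structure_constant (f r) (f s) (f t) = structure_constant r s t.
Proof.
move=> f_bij f_unit f_deg.
have f_eq x y : (f x == f y) = (x == y) := inj_eq (bij_inj f_bij) x y.
have f_ne x : x != unit_idx C1 -> f x != unit_idx C2 by rewrite -f_unit f_eq.
have f_order : calg_order C2 = calg_order C1.
  rewrite /calg_order (reindex f) /=; last exact: onW_bij.
  exact: eq_bigr.
have f_codeg x : codeg (f x) = codeg x by rewrite /codeg f_order f_deg.
pose kept r s t :=
  intersection_number (f r) (f s) (f t) = intersection_number r s t.
suff p_kept r s t : kept r s t by move=> r s t; rewrite !structure_constantE p_kept.
have kept_1l s' t' : kept (unit_idx C1) s' t'.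
  by rewrite /kept f_unit !intersection_number_1l f_eq.
have keptC r' s' t' : kept s' r' t' -> kept r' s' t'.
  by rewrite /kept intersection_numberC // [RHS]intersection_numberC.
have [->//|re] := eqVneq r (unit_idx C1).
have [->|se] := eqVneq s (unit_idx C1); first exact/keptC.
have [->|te] := eqVneq t (unit_idx C1).
  by rewrite /kept f_unit !intersection_number_unit // f_deg f_eq.
have kept_rr r' t' : r' != unit_idx C1 -> t' != unit_idx C1 -> kept r' r' t'.
  move: r' t' => {te re}r {}t re te; apply: complexI; rewrite -!structure_constantE.
  have [_ rrt1 rrr1] := formulas1 re re te.
  have [_ rrt2 rrr2] := formulas2 (f_ne _ re) (f_ne _ re) (f_ne _ te).
  have [rt|rt] := eqVneq r t.
    by rewrite rrr1 // rrr2 ?rt // f_codeg f_deg f_order.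
  by rewrite rrt1 // rrt2 ?f_eq // f_codeg f_deg f_order.
have [<-|rs] := eqVneq r s; first exact: kept_rr.
have kept_rsr r' s' : r' != unit_idx C1 -> s' != unit_idx C1 -> kept r' s' r'.
  by move=> r'e s'e; rewrite /kept !intersection_number_rsr // kept_rr // !f_deg.
have [->|tr] := eqVneq t r; first exact: kept_rsr.
have [->|st] := eqVneq s t; first exact/keptC/kept_rsr.
apply: complexI; rewrite -!structure_constantE.
have [rst1 _ _] := formulas1 re se te.
have [rst2 _ _] := formulas2 (f_ne _ re) (f_ne _ se) (f_ne _ te).
by rewrite rst1 // rst2 ?f_eq // !f_deg f_order.
Qed.

End Uniqueness.

(** * Bijections from equal multisets *)

Lemma perm_eq_codom_bij (T : eqType) (I J : finType) (a : I -> T) (b : J -> T) :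
  perm_eq (codom a) (codom b) -> exists2 f : I -> J, bijective f & b \o f =1 a.
Proof.
move=> ab.
have card_IJ : #|I| = #|J| by rewrite -(size_codom a) -(size_codom b) (perm_size ab).
have [g Eg] := @tuple_permP _ _ (codom a) (codom_tuple b) ab.
exists (fun x => enum_val (g (cast_ord card_IJ (enum_rank x)))).
  have cast_bij : bijective (cast_ord card_IJ).
    by exists (cast_ord (esym card_IJ)); [exact: cast_ordK|exact: cast_ordKV].
  exact: (bij_comp (@enum_val_bij J)
           (bij_comp (injF_bij (@perm_inj _ g)) (bij_comp cast_bij (enum_rank_bij I)))).
move=> x /=; rewrite -[in RHS](enum_rankK x) -(nth_codom (a x) a) Eg.
set k := cast_ord _ _.
rewrite (_ : nth _ _ _ = tnth [tuple tnth (codom_tuple b) (g i) | i < #|J|] k).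
  by rewrite tnth_mktuple (tnth_nth (a x)) nth_codom.
by rewrite (tnth_nth (a x)).
Qed.

(** Composing with the transposition of [f i] and [j] does no harm, as [b] takes
    the same value at both. *)
Lemma pointed_bij (T : eqType) (I J : finType) (a : I -> T) (b : J -> T)
    (i : I) (j : J) :
  a i = b j -> (exists2 f : I -> J, bijective f & b \o f =1 a) ->
  exists f : I -> J, [/\ bijective f, f i = j & b \o f =1 a].
Proof.
move=> ab [f f_bij bf]; exists (tperm (f i) j \o f); split.
- exact: bij_comp (injF_bij (@perm_inj _ _)) f_bij.
- by rewrite /= tpermL.
- move=> x /=; rewrite -bf /=; case: tpermP => [->|->|//].
    by rewrite -ab -bf.
  by rewrite [LHS]bf /= ab.
Qed.

Theorem theorem3p3 (R : realType) :
  [/\ forall C : calgebra R, amorphic C -> nontrivial C ->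
        exists2 eps : R, eps = -1 \/ eps = 1 & amorphic_formulas C eps,
      forall (C1 C2 : calgebra R) (eps : R),
        amorphic C1 -> nontrivial C1 -> amorphic C2 -> nontrivial C2 ->
        eps = -1 \/ eps = 1 ->
        amorphic_formulas C1 eps -> amorphic_formulas C2 eps ->
        perm_eq (degree_multiset C1) (degree_multiset C2) ->
        exists f : 'I_(calg_size C1) -> 'I_(calg_size C2),
          [/\ bijective f, f (unit_idx C1) = unit_idx C2,
              forall r, deg (f r) = deg r
            & forall r s t,
                structure_constant (f r) (f s) (f t) = structure_constant r s t]
    & forall (C1 C2 : calgebra R) (eps : R)
             (f : 'I_(calg_size C1) -> 'I_(calg_size C2)),
        amorphic C1 -> nontrivial C1 -> amorphic C2 -> nontrivial C2 ->
        eps = -1 \/ eps = 1 ->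
        amorphic_formulas C1 eps -> amorphic_formulas C2 eps ->
        bijective f -> f (unit_idx C1) = unit_idx C2 ->
        (forall r, deg (f r) = deg r) ->
        forall r s t,
          structure_constant (f r) (f s) (f t) = structure_constant r s t].
Proof.
split=> [C||C1 C2 eps f am1 nt1 am2 nt2 _ F1 F2].
- exact: amorphic_formulas_hold.
- move=> C1 C2 eps am1 nt1 am2 nt2 _ F1 F2 /perm_eq_codom_bij deg_bij.
  have deg1 : deg (unit_idx C1) = deg (unit_idx C2) by rewrite !deg_unit.
  have [f [f_bij f_unit f_deg]] := pointed_bij deg1 deg_bij.
  exists f; split=> //.
  exact: (structure_constants_determined am1 nt1 am2 nt2 F1 F2).
- exact: (structure_constants_determined am1 nt1 am2 nt2 F1 F2).
Qed.
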